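(* There exists a binary self-dual $[58,29,10]$ code whose weight enumerator is of the form $$W_{58,2}=1+(319-2\alpha-24\beta)x^{10}+(3132+2\alpha+152\beta)x^{12}+\cdots$$ with $\beta=1$ and $\alpha=118$.
   Context: A binary $[n,k,d]$ code is a $k$-dimensional linear subspace of $\mathbb{F}_2^n$ with minimum Hamming distance $d$. It is self-dual if it equals its dual with respect to the Euclidean inner product $\langle\mathbf{x},\mathbf{y}\rangle=\sum_i x_iy_i$. The weight enumerator is $\sum_i A_i x^i$, where $A_i$ is the number of codewords of Hamming weight $i$; in the displayed form, $\cdots$ stands for terms of higher degree, so the form specifies the coefficients of all powers of $x$ up to $x^{12}$. *)

(* Defs.v *)
From mathcomp Require Import all_boot all_order all_algebra.

Set Implicit Arguments.
Unset Strict Implicit.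
Unset Printing Implicit Defensive.

Import GRing.Theory.
Local Open Scope ring_scope.

Definition hamming_distance (n : nat) (x y : 'rV['F_2]_n) : nat :=
  #|[set i | x 0 i != y 0 i]|.

Definition hamming_weight (n : nat) (x : 'rV['F_2]_n) : nat :=
  #|[set i | x 0 i != 0]|.

Definition inner (n : nat) (x y : 'rV['F_2]_n) : 'F_2 :=
  \sum_(i < n) x 0 i * y 0 i.

Definition dual_code (n : nat) (C : {vspace 'rV['F_2]_n}) :
    {set 'rV['F_2]_n} :=
  [set x | [forall y in C, inner x y == 0]].

Definition self_dual (n : nat) (C : {vspace 'rV['F_2]_n}) : Prop :=
  C =i dual_code C.

(* The minimum is required to be attained, so the zero code has no
   minimum distance. *)
Definition has_min_distance (n : nat) (C : {vspace 'rV['F_2]_n}) (d : nat)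
    : Prop :=
  (exists x y : 'rV['F_2]_n,
      [/\ x \in C, y \in C, x != y & hamming_distance x y = d])
  /\ (forall x y : 'rV['F_2]_n,
      x \in C -> y \in C -> x != y -> (d <= hamming_distance x y)%N).

Definition binary_code (n k d : nat) (C : {vspace 'rV['F_2]_n}) : Prop :=
  \dim C = k /\ has_min_distance C d.

Arguments binary_code : clear implicits.

Definition num_of_weight (n : nat) (C : {vspace 'rV['F_2]_n}) (i : nat)
    : nat :=
  #|[set x in C | hamming_weight x == i]|.

Definition weight_enumerator (n : nat) (C : {vspace 'rV['F_2]_n})
    : {poly int} :=
  \sum_(i < n.+1) (num_of_weight C i)%:Z *: 'X^i.

(* The displayed form fixes the coefficients of all powers up to 'X^12; the
   dots are the terms of degree at least 13, i.e. a multiple of 'X^13. *)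
Definition form_W58_2 (alpha beta : int) (W : {poly int}) : Prop :=
  exists Q : {poly int},
    W = 1 + (319 - 2 * alpha - 24 * beta) *: 'X^10
          + (3132 + 2 * alpha + 152 * beta) *: 'X^12
          + Q * 'X^13.

(* Main.v *)
Require Import Defs.
From Stdlib Require Import BinPos.
From mathcomp Require Import zify.
From mathcomp Require Import all_boot all_order all_algebra.

Import GRing.Theory.

(** The code is generated by [[I | A]] with [A] an orthogonal matrix over F_2,
    so it is self-dual and each half of a codeword determines the other. A word
    of weight at most 12 has left weight at most 6 or right weight at most 5,
    hence the coefficients up to [x^12] are obtained by enumerating the sums of
    at most 6 rows of [A] and of at most 5 rows of [A^T].

    The matrix was found by a search through neighbours of self-dual codes. The
    search started from a [[58,29,10]] code with an automorphism of order 7 and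
    [beta = 0], [alpha = 156], and then moved to neighbours whose shadow has a
    single vector of weight 5 ([beta] counts these, [alpha] those of weight 9). *)

(** * Pruned enumeration of sums of few rows *)

Fixpoint xor_seq (s t : bitseq) : bitseq :=
  match s, t with
  | a :: s', b :: t' => (if a then ~~ b else b) :: xor_seq s' t'
  | _, _ => [::]
  end.

Fixpoint slack (s : bitseq) (m : nat) : option nat :=
  match s with
  | [::] => Some m
  | true :: s' => if m is m'.+1 then slack s' m' else None
  | false :: s' => slack s' m
  end.

(* For each set of at most [b] of the [rows], of size [c] and whose sum with [acc]
   has weight [w], with [c + w <= m]: the pair [(m - c, m - (c + w))]. The weights
   are counted down so that the leaf test stops as soon as the bound is exceeded. *)
Fixpoint slacks (rows : seq bitseq) (b m : nat) (acc : bitseq) : seq (nat * nat) :=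
  let leaf := if slack acc m is Some k then [:: (m, k)] else [::] in
  match rows, b, m with
  | r :: rows', b'.+1, m'.+1 =>
    slacks rows' b m acc ++ slacks rows' b' m' (xor_seq acc r)
  | _, _, _ => leaf
  end.

Fixpoint xor_rows (s : bitseq) (rows : seq bitseq) (acc : bitseq) : bitseq :=
  match s, rows with
  | b :: s', r :: rows' => xor_rows s' rows' (if b then xor_seq acc r else acc)
  | _, _ => acc
  end.

Definition transpose n (rows : seq bitseq) : seq bitseq :=
  mkseq (fun j => mkseq (fun i => nth false (nth [::] rows i) j) n) n.

(* Least significant bit first. *)
Fixpoint bits_of_pos (p : positive) : bitseq :=
  match p with
  | xH => [:: true]
  | xO p' => false :: bits_of_pos p'
  | xI p' => true :: bits_of_pos p'
  end.

(** A binary expansion stops at its leading one; the default [false] pads it with the missing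
    high-order zeros. *)
Definition bits n p := mkseq (nth false (bits_of_pos p)) n.

(* In [L'], [p.1 - p.2] is the weight of the other half: words with that half of
   weight at most 6 are already in [L]. *)
Definition weight_profile n rows : seq nat :=
  let L := slacks rows 6 12 (nseq n false) in
  let L' := slacks (transpose n rows) 5 12 (nseq n false) in
  [seq count (fun p => p.2 == 12 - i) L +
       count (fun p => (6 < p.1 - p.2) && (p.2 == 12 - i)) L' | i <- iota 0 13].

(** The unpruned enumeration of all subsets, the specification against which [slacks] is checked. *)
Fixpoint masks n : seq bitseq :=
  if n is n'.+1 then map (cons false) (masks n') ++ map (cons true) (masks n')
  else [:: [::]].

Lemma count_masks_weight0 n (Q : pred bitseq) :
  count (fun s => (count id s == 0) && Q s) (masks n) = Q (nseq n false).
Proof.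
elim: n Q => [|n IHn] Q /=; first by rewrite addn0.
rewrite count_cat !count_map.
rewrite (eq_count (a2 := fun s => (count id s == 0) && Q (false :: s))) //.
by rewrite IHn [X in _ + X](eq_count (a2 := pred0)) ?count_pred0 ?addn0.
Qed.

Lemma xor_rows_none n rows acc : xor_rows (nseq n false) rows acc = acc.
Proof. by elim: n rows => [|n IHn] [|r rows] /=. Qed.

Lemma slackE s m :
  slack s m = if count id s <= m then Some (m - count id s) else None.
Proof.
elim: s m => [|[] s IHs] m /=; rewrite ?subn0 //.
by case: m => [|m] //; rewrite IHs add1n ltnS subSS.
Qed.

(** Pruning loses nothing: once [b], [m] or the rows are exhausted, only the zero mask can meet the
    bounds, and it yields the leaf. Otherwise the masks split on their first bit exactly as the
    recursion does. *)
Lemma count_slacks rows b m acc (P : pred (nat * nat)) :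
  count P (slacks rows b m acc) =
  count (fun s => let t := count id s + count id (xor_rows s rows acc) in
           [&& count id s <= b, t <= m & P (m - count id s, m - t)])
        (masks (size rows)).
Proof.
pose leaf m acc := if slack acc m is Some k then [:: (m, k)] else [::].
have leafP n rows' b' m' acc' : (b' == 0) || (m' == 0) || (n == 0) ->
  count P (leaf m' acc') =
  count (fun s => let t := count id s + count id (xor_rows s rows' acc') in
           [&& count id s <= b', t <= m' & P (m' - count id s, m' - t)]) (masks n).
  move=> bm0; rewrite /leaf slackE.
  pose Q s := (count id (xor_rows s rows' acc') <= m') &&
    P (m', m' - count id (xor_rows s rows' acc')).
  transitivity (count (fun s => (count id s == 0) && Q s) (masks n)).
    rewrite count_masks_weight0 /Q xor_rows_none.
    by case: (_ <= m') => //=; rewrite addn0.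
  apply: eq_in_count => s sn /=.
  have [s0|s0] := eqVneq (count id s) 0; first by rewrite s0 subn0 add0n.
  rewrite andbA.
  have -> // : (count id s <= b') && (count id s + count id (xor_rows s rows' acc') <= m') = false.
  case/orP: bm0 => [/orP[]|] /eqP h.
  - by rewrite h leqn0 (negbTE s0).
  - by rewrite h leqn0 addn_eq0 (negbTE s0) andbF.
  by move: sn s0; rewrite h inE => /eqP ->.
elim: rows b m acc => [|r rows IHrows] [|b] [|m] acc; try exact: leafP.
rewrite /= !count_cat !count_map !IHrows; congr addn.
Qed.

(** * Arithmetic and Hamming weights over F_2 *)

Local Open Scope ring_scope.

Lemma F2_cases (a : 'F_2) : a = 0 \/ a = 1.
Proof. by case: a => [[|[|m]] Hm] //; [left|right]; apply: val_inj. Qed.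

Lemma oppF2 (a : 'F_2) : - a = a.
Proof. by case: (F2_cases a) => ->; apply: val_inj. Qed.

Lemma F2_neq0 (a : 'F_2) : a = (a != 0)%:R.
Proof. by case: (F2_cases a) => ->; apply: val_inj. Qed.

Lemma oppF2_mx m n (x : 'M['F_2]_(m, n)) : - x = x.
Proof. by apply/matrixP => i j; rewrite mxE oppF2. Qed.

Lemma inner_mulmx n (x y : 'rV['F_2]_n) : inner x y = (x *m y^T) 0 0.
Proof. by rewrite mxE; apply: eq_bigr => i _; rewrite mxE. Qed.

Lemma hamming_weightE n (x : 'rV['F_2]_n) :
  hamming_weight x = (\sum_i (x 0%R i != 0%R))%N.
Proof.
rewrite /hamming_weight -sum1_card big_mkcond /=.
by apply: eq_bigr => i _; rewrite inE; case: (_ != _).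
Qed.

Lemma hamming_weight_row_mx m n (x : 'rV['F_2]_m) (y : 'rV['F_2]_n) :
  hamming_weight (row_mx x y) = (hamming_weight x + hamming_weight y)%N.
Proof.
rewrite !hamming_weightE big_split_ord /=.
by congr addn; apply: eq_bigr => i _; rewrite ?row_mxEl ?row_mxEr.
Qed.

Lemma hamming_weight_eq0 n (x : 'rV['F_2]_n) :
  (hamming_weight x == 0)%N = (x == 0).
Proof.
apply/eqP/eqP => [/eqP|->].
  rewrite cards_eq0 => /eqP/setP Hx; apply/rowP => i.
  by have := Hx i; rewrite !inE mxE => /negbFE/eqP.
by apply/eqP; rewrite cards_eq0; apply/eqP/setP=> i; rewrite !inE mxE eqxx.
Qed.

Lemma hamming_distanceE n (x y : 'rV['F_2]_n) :
  hamming_distance x y = hamming_weight (x - y).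
Proof.
by apply: eq_card => i; rewrite !inE !mxE subr_eq0.
Qed.

(** * Codes generated by [[I | A]] with [A] orthogonal *)

Definition systematic_code n (A : 'M['F_2]_n) : {vspace 'rV['F_2]_(n + n)} :=
  limg (linfun (mulmxr (row_mx 1%:M A))).

Section SystematicCode.

Variables (n : nat) (A : 'M['F_2]_n).
Hypothesis AAT : A *m A^T = 1%:M.

Local Notation C := (systematic_code n A).

Let ATA : A^T *m A = 1%:M := mulmx1C AAT.

Lemma systematic_codeP x :
  reflect (exists u, x = row_mx u (u *m A)) (x \in C).
Proof.
apply: (iffP memv_imgP) => [[u _ ->]|[u ->]]; exists u; rewrite ?memvf //.
  by rewrite lfunE /= mul_mx_row mulmx1.
by rewrite lfunE /= mul_mx_row mulmx1.
Qed.

Lemma dim_systematic_code : \dim C = n.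
Proof.
rewrite /systematic_code limg_dim_eq; first by rewrite dimvf /dim /= mul1n.
apply/eqP; rewrite capfv -subv0; apply/subvP => u.
rewrite memv_ker memv0 lfunE /= mul_mx_row mulmx1 -row_mx0 => /eqP/eq_row_mx[-> _].
by [].
Qed.

Lemma systematic_code_self_dual : self_dual C.
Proof.
move=> x; rewrite inE; apply/systematic_codeP/'forall_implyP => [[u ->] y|Hx].
  move=> /systematic_codeP[v ->]; rewrite inner_mulmx tr_row_mx mul_row_col.
  (* The two halves contribute [u *m v^T] each, which cancel in characteristic 2. *)
  rewrite trmx_mul mulmxA -(mulmxA u) AAT mulmx1 -{1}(oppF2_mx _ _ (u *m v^T)).
  by rewrite addNr mxE.
exists (lsubmx x); rewrite -{1}(hsubmxK x); congr row_mx.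
(* Testing [x] against the generators [(e_i | e_i A)] gives this equation coordinatewise;
   multiplying it by [A] recovers the right half from the left. *)
have E : lsubmx x + rsubmx x *m A^T = 0.
  apply/rowP => i; rewrite [RHS]mxE.
  pose y := row_mx (delta_mx 0 i : 'rV_n) (delta_mx 0 i *m A).
  have /Hx/eqP : y \in C by apply/systematic_codeP; exists (delta_mx 0 i).
  rewrite inner_mulmx -{1}(hsubmxK x) tr_row_mx mul_row_col => <-.
  by rewrite trmx_mul mulmxA -mulmxDl trmx_delta -colE [RHS]mxE.
rewrite -[lsubmx x]oppF2_mx.
move/eqP: E; rewrite addr_eq0 => /eqP ->.
by rewrite opprK -mulmxA ATA mulmx1.
Qed.

Lemma num_of_weight_systematic_code i :
  num_of_weight C i =
  #|[set u : 'rV_n | hamming_weight u + hamming_weight (u *m A) == i]%N|.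
Proof.
rewrite /num_of_weight.
pose f (u : 'rV['F_2]_n) := row_mx u (u *m A).
have f_inj : injective f by move=> u v /eq_row_mx[].
rewrite -(card_imset _ f_inj); apply: eq_card => x; rewrite !inE.
apply/andP/imsetP => [[/systematic_codeP[u ->] Hw]|[u]].
  by exists u; rewrite // inE -hamming_weight_row_mx.
by rewrite inE -hamming_weight_row_mx => Hu ->; split=> //; apply/systematic_codeP; exists u.
Qed.

(* [A] is invertible with inverse [A^T], so a codeword is determined by either half. *)
Lemma num_of_weight_split b i :
  num_of_weight C i =
  (#|[set u : 'rV_n | (hamming_weight u <= b) &&
       (hamming_weight u + hamming_weight (u *m A) == i)]| +
   #|[set v : 'rV_n | (b < hamming_weight (v *m A^T)) &&
       (hamming_weight v + hamming_weight (v *m A^T) == i)]|)%N.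
Proof.
rewrite num_of_weight_systematic_code.
rewrite -(cardsID [set u | hamming_weight u <= b]%N); congr addn.
  by apply: eq_card => u; rewrite !inE andbC.
have inj : injective (fun v : 'rV['F_2]_n => v *m A^T).
  by move=> u v /(congr1 (mulmx^~ A)); rewrite -!mulmxA ATA !mulmx1.
rewrite -[RHS](card_imset _ inj); apply: eq_card => u; rewrite !inE -ltnNge.
apply/idP/imsetP => [Hu|[v Hv ->]].
  (* Words of large left weight are indexed by their right half [u *m A], from which [A^T] returns
     [u]. *)
  exists (u *m A); last by rewrite -mulmxA AAT mulmx1.
  by rewrite inE -mulmxA AAT mulmx1 addnC.
by move: Hv; rewrite inE -mulmxA ATA mulmx1 addnC.
Qed.

End SystematicCode.

(** * From weight counts to minimum distance and enumerator *)

Lemma has_min_distance_num_of_weight n (C : {vspace 'rV['F_2]_n}) d :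
  (0 < d)%N -> (0 < num_of_weight C d)%N ->
  (forall i, (0 < i < d)%N -> num_of_weight C i = 0%N) ->
  has_min_distance C d.
Proof.
move=> d0 /card_gt0P[x]; rewrite inE => /andP[xC /eqP xd] H0; split.
  exists x, 0; rewrite mem0v hamming_distanceE subr0 xC xd; split=> //.
  by rewrite -hamming_weight_eq0 xd -lt0n.
move=> {xC xd}x y xC yC; rewrite -subr_eq0 -hamming_weight_eq0 -lt0n => w0.
rewrite hamming_distanceE leqNgt; apply/negP => wd.
have /eqP := H0 _ (introT andP (conj w0 wd)).
rewrite cards_eq0 => /eqP/setP/(_ (x - y)).
by rewrite !inE eqxx memvB.
Qed.

Lemma form_W58_2_num_of_weight (C : {vspace 'rV['F_2]_58}) (alpha beta : int) :
  num_of_weight C 0 = 1%N ->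
  (num_of_weight C 10)%:Z = 319 - 2 * alpha - 24 * beta ->
  (num_of_weight C 12)%:Z = 3132 + 2 * alpha + 152 * beta ->
  (forall i, (i < 13)%N -> i \notin [:: 0; 10; 12]%N -> num_of_weight C i = 0%N) ->
  form_W58_2 alpha beta (weight_enumerator C).
Proof.
move=> A0 A10 A12 Ai.
(* The degrees 13 to 58 make up the 46 remaining terms. *)
exists (\sum_(i < 46) (num_of_weight C (13 + i))%:Z *: 'X^i).
rewrite -A10 -A12 /weight_enumerator (big_split_ord _ (m := 13) (n := 46)) /=.
congr (_ + _); last first.
  by rewrite mulr_suml; apply: eq_bigr => i _; rewrite -scalerAl -exprD addnC.
rewrite -(big_mkord xpredT (fun i => (num_of_weight C i)%:Z *: 'X^i)) unlock /=.
(* The nine rewrites clear degrees 1 to 9; 11 is named because the next match would be degree 10. *)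
rewrite A0; do 9! rewrite Ai //; rewrite (Ai 11%N) //.
by rewrite -[Posz 0]/(0 : int) -[Posz 1]/(1 : int) !scale0r scale1r expr0 !add0r addr0 addrA.
Qed.

(** * Transfer between bit sequences and vectors over F_2 *)

Definition vec n (s : bitseq) : 'rV['F_2]_n := \row_i (nth false s i)%:R.

Definition bits_mx n (rows : seq bitseq) : 'M['F_2]_n :=
  \matrix_(i, j) (nth false (nth [::] rows i) j)%:R.

Definition bits_of_vec n (u : 'rV['F_2]_n) : bitseq := [seq u 0 i != 0 | i <- enum 'I_n].

Lemma size_masks n s : s \in masks n -> size s = n.
Proof.
elim: n s => [|n IHn] s /=; first by rewrite inE => /eqP ->.
by rewrite mem_cat => /orP[] /mapP[t /IHn <- ->].
Qed.

Lemma mem_masks s : s \in masks (size s).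
Proof.
elim: s => [|b s IHs] //=; rewrite mem_cat.
by case: b; rewrite map_f ?orbT.
Qed.

Lemma uniq_masks n : uniq (masks n).
Proof.
elim: n => //= n IHn; rewrite cat_uniq !map_inj_uniq ?IHn //; try by move=> s t [].
rewrite andbT /=; apply/hasPn => _ /mapP[s _ ->].
by apply/mapP => -[].
Qed.

Lemma F2_bool_neq0 (b : bool) : ((b%:R : 'F_2) != 0) = b.
Proof. by case: b. Qed.

Lemma vecK n s : size s = n -> bits_of_vec n (vec n s) = s.
Proof.
move=> sn; apply: (@eq_from_nth _ false); rewrite size_map size_enum_ord // => i lin.
by rewrite (nth_map (Ordinal lin)) ?size_enum_ord // mxE nth_enum_ord // F2_bool_neq0.
Qed.

Lemma bits_of_vecK n (u : 'rV['F_2]_n) : vec n (bits_of_vec n u) = u.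
Proof.
apply/rowP => i; rewrite mxE (nth_map i) ?size_enum_ord // nth_ord_enum.
by rewrite -F2_neq0.
Qed.

(** Through [vec], [masks n] lists every vector exactly once, so cardinals become computable
    counts. *)
Lemma card_vec n (Q : pred 'rV['F_2]_n) :
  #|[set u | Q u]| = count (fun s => Q (vec n s)) (masks n).
Proof.
rewrite cardsE cardE /enum_mem size_filter -enumT.
rewrite -(count_map (vec n) Q); apply: permP.
apply: uniq_perm; rewrite ?enum_uniq //.
  rewrite map_inj_in_uniq ?uniq_masks // => s t /size_masks sn /size_masks tn st.
  by rewrite -(vecK _ _ sn) -(vecK _ _ tn) st.
move=> u; rewrite mem_enum; apply/esym/mapP; exists (bits_of_vec n u).
  by rewrite -[n in masks n](size_enum_ord n) -(size_map (fun i => u 0 i != 0)) mem_masks.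
by rewrite bits_of_vecK.
Qed.

Lemma hamming_weight_vec n s : size s = n -> hamming_weight (vec n s) = count id s.
Proof.
move=> sn; rewrite hamming_weightE -sum1_count [RHS]big_mkcond /=.
rewrite (big_nth false) sn big_mkord; apply: eq_bigr => i _.
by rewrite mxE F2_bool_neq0; case: nth.
Qed.

Lemma size_xor_seq s t : size s = size t -> size (xor_seq s t) = size s.
Proof. by elim: s t => [|a s IHs] [|b t] //= [/IHs ->]. Qed.

Lemma size_xor_rows n s rows acc :
  all (fun r => size r == n) rows -> size acc = n -> size (xor_rows s rows acc) = n.
Proof.
elim: s rows acc => [|b s IHs] [|r rows] acc //= /andP[/eqP rn rowsn] accn.
by apply: IHs => //; case: b; rewrite // size_xor_seq accn ?rn.
Qed.

Lemma vec_xor n s t : size s = n -> size t = n -> vec n (xor_seq s t) = vec n s + vec n t.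
Proof.
move=> sn tn; apply/rowP => -[i lin]; rewrite !mxE /=.
elim: s t n sn tn i lin => [|a s IHs] [|b t] [|n] // [sn] [tn] [|i] lin /=.
  by case: a; case: b; apply: val_inj.
exact: (IHs _ n).
Qed.

Lemma vec_xor_rows n k s rows acc :
  all (fun r => size r == n) rows -> size rows = k -> size s = k -> size acc = n ->
  vec n (xor_rows s rows acc) = vec n acc + \sum_(i < k) vec k s 0 i *: vec n (nth [::] rows i).
Proof.
elim: k s rows acc => [|k IHk] [|b s] [|r rows] acc //=.
  by rewrite big_ord0 addr0.
move=> /andP[/eqP rn rowsn] [rowsk] [sk] accn.
rewrite IHk //; last by case: b; rewrite // size_xor_seq ?rn.
rewrite big_ord_recl addrA; congr (_ + _); last first.
  by apply: eq_bigr => i _; rewrite !mxE.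
by rewrite mxE /=; case: b; rewrite ?scale0r ?addr0 // scale1r vec_xor.
Qed.

Lemma vec_xor_rows_mul n s rows :
  all (fun r => size r == n) rows -> size rows = n -> size s = n ->
  vec n (xor_rows s rows (nseq n false)) = vec n s *m bits_mx n rows.
Proof.
move=> rowsn rn sn; rewrite (vec_xor_rows n n) ?size_nseq //.
have -> : vec n (nseq n false) = 0.
  by apply/rowP => i; rewrite !mxE nth_nseq if_same.
rewrite add0r mulmx_sum_row; apply: eq_bigr => i _; congr (_ *: _).
by apply/rowP => j; rewrite !mxE.
Qed.

Lemma tr_bits_mx n rows : (bits_mx n rows)^T = bits_mx n (transpose n rows).
Proof. by apply/matrixP => i j; rewrite !mxE !nth_mkseq. Qed.

Lemma size_transpose n rows : size (transpose n rows) = n.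
Proof. by rewrite size_mkseq. Qed.

Lemma all_size_transpose n rows : all (fun r => size r == n) (transpose n rows).
Proof. by apply/allP => r /mapP[j _ ->]; rewrite size_mkseq. Qed.

Definition is_orthogonal_rows n rows :=
  [&& size rows == n, all (fun r => size r == n) rows &
   [seq xor_rows r (transpose n rows) (nseq n false) | r <- rows]
     == [seq [seq i == j | j <- iota 0 n] | i <- iota 0 n]].

(** Row [i] of the product is the sum of the rows of the transpose selected by row [i] of the
    matrix, which is what the boolean test evaluates. *)
Lemma bits_mx_orthogonal n rows :
  is_orthogonal_rows n rows -> bits_mx n rows *m (bits_mx n rows)^T = 1%:M.
Proof.
case/and3P=> /eqP rn rowsn /eqP E; apply/row_matrixP => i.
have iE : row i (bits_mx n rows) = vec n (nth [::] rows i).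
  by apply/rowP => j; rewrite !mxE.
have lin : (i < size rows)%N by rewrite rn.
rewrite row_mul iE tr_bits_mx -vec_xor_rows_mul ?size_transpose ?all_size_transpose //; last first.
  by apply/eqP/(allP rowsn); rewrite mem_nth.
have /(congr1 (nth [::] ^~ i)) := E.
rewrite (nth_map [::]) // (nth_map 0%N) ?size_iota // nth_iota // add0n => ->.
by apply/rowP => j; rewrite !mxE (nth_map 0%N) ?size_iota // nth_iota // add0n.
Qed.

Lemma num_of_weight_bits_mx n rows i :
  is_orthogonal_rows n rows -> (i < 13)%N ->
  num_of_weight (systematic_code _ (bits_mx n rows)) i = nth 0%N (weight_profile n rows) i.
Proof.
move=> On i13; have AAT := bits_mx_orthogonal _ _ On.
case/and3P: On => /eqP rn rowsn _.
rewrite (num_of_weight_split _ _ AAT 6).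
rewrite (nth_map 0%N 0%N) ?size_iota //.
rewrite (nth_iota _ _ i13).
rewrite add0n.
rewrite !count_slacks rn size_transpose; congr addn; rewrite card_vec.
  apply: eq_in_count => s /size_masks sn.
  rewrite hamming_weight_vec // -vec_xor_rows_mul // hamming_weight_vec ?(size_xor_rows n) ?size_nseq //=.
  (* As [i <= 12], the truncated equation [12 - (c + w) = 12 - i] with [c + w <= 12] means
     [c + w = i]. *)
  by move: (count _ _) (count _ _) => c w; lia.
apply: eq_in_count => s /size_masks sn.
rewrite tr_bits_mx hamming_weight_vec // -vec_xor_rows_mul ?size_transpose ?all_size_transpose //.
rewrite hamming_weight_vec ?(size_xor_rows n) ?all_size_transpose ?size_nseq //=.
(* Here [w > 6] and [c + w <= 12] force [c <= 5], so the bound 5 on the number of rows excludes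
   nothing. *)
by move: (count _ _) (count _ _) => c w; lia.
Qed.

(** * The explicit matrix and its code *)

Definition rows58 : seq bitseq := [seq bits 29 p | p <- [::
   165106866; 328747394; 467369303; 78240749; 324414026;
   398708724; 220913775; 492111920; 280614124; 432586338;
   215657068; 249739909; 389336334; 142790199; 114838965;
   9172051; 345243501; 136799830; 284502390; 266990483;
   319129412; 148983560; 54220690; 81892693; 15538754;
   404861915; 277126239; 89472431; 235915280]%positive].

Lemma rows58_orthogonal : is_orthogonal_rows 29 rows58.
Proof. by vm_compute. Qed.

(** The computation visits 621616 sums of at most 6 rows and 146596 sums of at most 5 columns. *)
Lemma rows58_profile :
  weight_profile 29 rows58 = [:: 1; 0; 0; 0; 0; 0; 0; 0; 0; 0; 59; 0; 3520]%N.
Proof. by vm_compute. Qed.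

Theorem mainTheorem3 :
  exists C : {vspace 'rV['F_2]_58},
    [/\ binary_code 58 29 10 C,
        self_dual C
      & form_W58_2 118 1 (weight_enumerator C)].
Proof.
have AAT := bits_mx_orthogonal _ _ rows58_orthogonal.
pose C : {vspace 'rV['F_2]_58} := systematic_code _ (bits_mx 29 rows58).
have Cw i : (i < 13)%N ->
    num_of_weight C i = nth 0%N [:: 1; 0; 0; 0; 0; 0; 0; 0; 0; 0; 59; 0; 3520]%N i.
  by move=> i13; rewrite -rows58_profile -num_of_weight_bits_mx ?rows58_orthogonal.
exists C; split.
- split; first exact: (dim_systematic_code 29 (bits_mx 29 rows58)).
  apply: has_min_distance_num_of_weight; rewrite ?Cw // => i /andP[i0 i10].
  rewrite Cw; last exact: ltn_trans i10 _.
  by move: i i0 i10; do 10! case=> //.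
- exact: (systematic_code_self_dual 29 (bits_mx 29 rows58) AAT).
(* The counts match: 319 - 2*118 - 24 = 59 and 3132 + 2*118 + 152 = 3520. *)
apply: form_W58_2_num_of_weight; rewrite ?Cw // => i i13.
by rewrite Cw //; move: i i13; do 13! case=> //.
Qed.
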